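(* For every real $\tau$ with $0\le\tau\le 1$, $$R(\tau)\ \ge\ \underline{R}(\tau):=(1+\tau)-(1+\tau)\log_2(1+\tau)+\tau\log_2\tau ,$$ with the convention $0\log_2 0=0$.
   Context: Binary Z-channel with noiseless feedback: an input symbol $0$ is always received as $0$; an input symbol $1$ is received either as $1$ or (an error) as $0$. A feedback encoding strategy of blocklength $n$ for a finite message set $\mathcal M$ is a collection of functions $c_i:\mathcal M\times\{0,1\}^{i-1}\to\{0,1\}$, $i=1,\dots,n$; when sending $m$, the $i$-th transmitted symbol is $c_i(m,y^{i-1})$, where $y^{i-1}=(y_1,\dots,y_{i-1})$ are the previously received symbols (known to the sender through feedback). Write $c(m,y^{n-1})=(c_1(m),c_2(m,y_1),\dots,c_n(m,y^{n-1}))$. For an integer $t\ge0$ let $\mathcal Y^n_t(m)=\{y^n\in\{0,1\}^n: y_i\le c_i(m,y^{i-1})\text{ for all }i,\ d_H(y^n,c(m,y^{n-1}))\le t\}$, where $d_H$ is the Hamming distance. The strategy is successful if $\mathcal Y^n_t(m_1)\cap\mathcal Y^n_t(m_2)=\emptyset$ for all distinct $m_1,m_2\in\mathcal M$. $M(n,t)$ is the maximum $|\mathcal M|$ for which a successful strategy of blocklength $n$ with at most $t$ errors exists. For $0\le\tau\le1$, $R(\tau):=\limsup_{n\to\infty}\frac{1}{n}\log_2 M(n,\lceil\tau n\rceil)$. All logarithms are base $2$. *)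

(* Defs.v *)
From HB Require Import structures.
From mathcomp Require Import all_boot all_order all_algebra.
From mathcomp Require Import boolp classical_sets reals ereal sequences exp.
Set Implicit Arguments. Unset Strict Implicit. Unset Printing Implicit Defensive.
Import Order.TTheory GRing.Theory Num.Theory.

(* A feedback encoding strategy for the message set 'I_k:
   c m y^{i-1} is the i-th transmitted symbol c_i(m, y^{i-1});
   the time index i is determined by the length (i-1) of the received prefix. *)
Definition strategy (k : nat) := 'I_k -> seq bool -> bool.

(* Y^n_t(m): outputs y (length n) with y_i <= c_i(m,y^{i-1}) (Z-channel)
   and at most t positions where y_i differs from the transmitted symbol.
   Indices are 0-based: position i uses the prefix take i y. *)
Definition Yset (n t k : nat) (c : strategy k) (m : 'I_k) (y : n.-tuple bool) : bool :=
  [forall i : 'I_n, (tnth y i <= c m (take i y))%N] &&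
  (#|[set i : 'I_n | tnth y i != c m (take i y)]| <= t)%N.

Definition successful (n t k : nat) (c : strategy k) : Prop :=
  forall m1 m2 : 'I_k, m1 != m2 ->
    forall y : n.-tuple bool, ~~ (Yset t c m1 y && Yset t c m2 y).

Definition achievable (n t k : nat) : Prop := exists c : strategy k, successful n t c.

(* M(n,t): the maximum k achievable.  Any successful strategy has k <= 2^n
   (the error-free output lies in Y_t(m) and these sets are disjoint), so the
   maximum over k <= 2^n is the maximum over all k. *)
Definition Mnt (n t : nat) : nat :=
  (\max_(k < (2 ^ n).+1 | `[< achievable n t k >]) k)%N.

Local Open Scope ring_scope.

Definition log2 {R : realType} (x : R) : R := ln x / ln 2.

Definition xlog2x {R : realType} (x : R) : R := if x == 0 then 0 else x * log2 x.

Definition Rrate {R : realType} (tau : R) : \bar R :=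
  limn_esup (fun n : nat =>
    ((log2 ((Mnt n `|Num.ceil (tau * n%:R)|%N)%:R : R)) / n%:R)%:E).

Definition Rlow {R : realType} (tau : R) : R :=
  (1 + tau) - (1 + tau) * log2 (1 + tau) + xlog2x tau.

(* Main.v *)
Require Import Defs.
From HB Require Import structures.
From mathcomp Require Import all_boot all_order all_algebra.
From mathcomp Require Import boolp classical_sets reals ereal sequences exp.
From mathcomp Require Import ring lra fintype finset.
Import Order.TTheory GRing.Theory Num.Theory.
Set Implicit Arguments. Unset Strict Implicit. Unset Printing Implicit Defensive.
Local Open Scope ring_scope.

(** Fix [q] in (0, 1) and give a candidate message that has already suffered [j]
    errors the mass [q ^ j].  If the candidates sending 1 carry the share
    [1 / (2 - q)] of the total mass, either channel output divides the total mass
    by [2 - q]; since surviving candidates weigh at least [q ^ t], this suggests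
    that [(2 - q) ^ n * q ^ t] messages can be told apart, and
    [q = 2 tau / (1 + tau)] gives the stated rate.

    The shares cannot be met exactly when few candidates carry most of the mass.
    Write [v = L ^ - r * Q ^ - e] with [L ^ N = 2 - q] and [Q ^ N = q] for a
    candidate with [e] errors and [r] steps left, and charge it
    [min (G ^ (N - 1) * v ^ N) v].  Candidates charged the first term weigh at most
    [4 / G], which is exponentially small, so they can be split almost exactly.
    For the others the weight grows only by the factor [L], close to 1, and this
    leaves room for coarse splits, unless one candidate has more than the share
    [1 - 1 / L].  Such a leader is exempted from the charge and sends 0 while the
    other heavy candidates send 1: an output 1 removes the leader, an output 0
    costs each of them an error. *)

(** * The coding problem as a game on error budgets *)

Section Game.
Variable T : finType.

(* A state gives the number of errors a candidate may still suffer, [None] if it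
   is excluded; [X] is the set of candidates sending 1 and [b] the output. *)
Definition update (s : T -> option nat) (X : {set T}) (b : bool) : T -> option nat :=
  fun m => if b then (if m \in X then s m else None)
           else if m \in X then (if s m is Some e.+1 then Some e else None)
           else s m.

Fixpoint winnable (r : nat) (s : T -> option nat) : Prop :=
  if r is r'.+1 then
    exists X : {set T}, forall b, winnable r' (update s X b)
  else forall m1 m2, s m1 != None -> s m2 != None -> m1 = m2.

Fixpoint run (c : T -> seq bool -> bool) (s : T -> option nat) (y : seq bool) :=
  if y is b :: y' then
    run (fun m p => c m (b :: p)) (update s [set m | c m [::]] b) y'
  else s.

(** Feedback lets the sender continue differently after each output: the first received symbol
    selects which of the two inductively built strategies handles the rest. *)
Lemma winnable_strategy r s : winnable r s ->
  exists c : T -> seq bool -> bool, forall y, size y = r ->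
    forall m1 m2, run c s y m1 != None -> run c s y m2 != None -> m1 = m2.
Proof.
elim: r s => [|r IH] s /=.
  by move=> w; exists (fun _ _ => false) => -[].
move=> [X w].
have [c1 h1] := IH _ (w true); have [c0 h0] := IH _ (w false).
exists (fun m p => if p is b :: p' then (if b then c1 m p' else c0 m p')
                   else m \in X).
move=> [|b y] //= [sy].
have -> : [set m | m \in X] = X by apply/setP => m; rewrite inE.
by case: b; [exact: h1|exact: h0].
Qed.

Lemma run_alive (y : seq bool) (c : T -> seq bool -> bool) s m t :
  s m = Some t ->
  (forall i, (i < size y)%N -> (nth false y i <= c m (take i y))%N) ->
  (\sum_(i < size y) (nth false y i != c m (take i y)) <= t)%N ->
  run c s y m != None.
Proof.
elim: y c s t => [|b y IH] c s t sm le_yc; first by rewrite /= sm.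
rewrite big_ord_recl /= => lies.
have le_b := le_yc 0%N isT.
(* The budget after the first symbol: one less exactly when that symbol was received wrongly. *)
pose t' := (t - (b != c m [::]))%N.
apply: (IH _ _ t').
- rewrite /update inE sm; move: le_b lies; rewrite /t' /=.
  case: b {le_yc t'}; case: (c m [::]) => //=; rewrite ?subn0 //.
  by case: t {sm} => [|t] //; rewrite subn1.
- by move=> i lt_i; exact: (le_yc i.+1).
- by rewrite leq_subRL; [exact: lies | apply: leq_trans lies; rewrite leq_addr].
Qed.

End Game.

Lemma winnable_achievable n t k :
  @winnable 'I_k n (fun=> Some t) -> achievable n t k.
Proof.
move=> /winnable_strategy[c hc]; exists c => m1 m2 ne y.
have alive m : Yset t c m y -> run c (fun=> Some t) y m != None.
  move=> /andP[/forallP le_yc lies]; apply: (run_alive (t := t)) => //.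
    move=> i; rewrite size_tuple => lt_i.
    by have := le_yc (Ordinal lt_i); rewrite (tnth_nth false).
  rewrite size_tuple; apply: leq_trans lies.
  rewrite -sum1_card; apply: eq_leq; rewrite [RHS]big_mkcond; apply: eq_bigr => i _.
  by rewrite inE (tnth_nth false); case: (_ != _).
apply/negP => /andP[/alive h1 /alive h2].
by move/eqP: ne; apply; exact: hc (size_tuple y) _ _ h1 h2.
Qed.

(** * Splitting a mass by subset sums *)

Section Split.
Variables (R : realFieldType) (T : finType).
Implicit Types (J A : {set T}) (x : T -> R).

(** Take a subset of maximal cardinality among those not exceeding [goal]. Any further element would
    overshoot, and each element contributes at most [d]. *)
Lemma subset_sum_approx J x (d goal : R) :
  0 <= goal <= \sum_(m in J) x m -> 0 <= d ->
  (forall m, m \in J -> x m <= d) ->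
  exists2 A : {set T}, A \subset J & goal - d <= \sum_(m in A) x m <= goal.
Proof.
move=> /andP[goal0 goalJ] d0 xd.
pose P A := (A \subset J) && (\sum_(m in A) x m <= goal).
have P0 : P set0 by rewrite /P sub0set big_set0.
have [A /andP[AJ Ag] maxA] := arg_maxnP (fun A => #|A|) P0.
exists A => //; rewrite Ag andbT.
have [JA|/subsetPn[m mJ mA]] := boolP (J \subset A).
  have -> : A = J by apply/eqP; rewrite eqEsubset AJ JA.
  by lra.
have : ~~ P (m |: A).
  by apply/negP => /maxA; rewrite cardsU1 mA /= add1n ltnn.
rewrite /P subUset sub1set mJ AJ /= -ltNge big_setU1 //= => h.
by have := xd m mJ; lra.
Qed.

Lemma sum_subset A J x : A \subset J ->
  \sum_(m in J) x m = \sum_(m in A) x m + \sum_(m in J :\: A) x m.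
Proof. by move=> AJ; rewrite (big_setID A) (setIidPr AJ). Qed.

(** For [A] of mass exactly [S / (2 - q)] both left sides equal [S]. Missing that goal by at most
    [d] costs at most [(2 - q) * (1 - q) * d] in the second, hence the [2 * d]. *)
Lemma light_split J x (d q : R) : 0 < q < 1 -> 0 <= d ->
  (forall m, m \in J -> 0 <= x m <= d) ->
  exists2 A : {set T}, A \subset J &
    (2 - q) * \sum_(m in A) x m <= \sum_(m in J) x m /\
    (2 - q) * \sum_(m in J :\: A) x m + (2 - q) * q * \sum_(m in A) x m
      <= \sum_(m in J) x m + 2 * d.
Proof.
move=> /andP[q0 q1] d0 hx.
set S := \sum_(m in J) x m.
have S0 : 0 <= S by apply: sumr_ge0 => m /hx /andP[].
have l0 : 0 < 2 - q by lra.
have [||m /hx/andP[]|A AJ /andP[lo hi]] := @subset_sum_approx J x d (S / (2 - q)) => //.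
  rewrite divr_ge0 ?(ltW l0) //= ler_pdivrMr //; rewrite -/S; nra.
have hi' : (2 - q) * \sum_(m in A) x m <= S by rewrite mulrC -ler_pdivlMr.
have lo' : S <= (2 - q) * (\sum_(m in A) x m + d).
  by rewrite mulrC -ler_pdivrMr //; lra.
exists A => //; split => //.
have : S = _ := sum_subset x AJ; set a := \sum_(m in A) x m in hi' lo' *.
set b := \sum_(m in J :\: A) x m => Sab; rewrite {}Sab in hi' lo' *.
have := mulr_ge0 (ltW q0) d0.
have : (1 - q) * (a + b) <= (1 - q) * ((2 - q) * (a + d)) by apply: ler_wpM2l => //; lra.
have : 0 <= q * (3 - q) * d by apply: mulr_ge0 => //; nra.
nra.
Qed.

End Split.

(** * The potential of a state and its preservation *)

Section Potential.
Variables (R : realFieldType) (T : finType).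
Variables (L Q q G : R) (p : nat).
Hypothesis q01 : 0 < q < 1.
Hypothesis L12 : 1 < L < 2.
Hypothesis Q01 : 0 < Q < 1.
Hypothesis LE : L ^+ p.+2 = 2 - q.
Hypothesis QE : Q ^+ p.+2 = q.
Hypothesis LQ : 2 * (L - 1) ^+ 2 <= (1 - L * Q) * (2 - L).
Hypothesis G1 : 1 < G.

Let K := G ^+ p.+1.
Let d := 4 / G.

Definition base (r : nat) (o : option nat) : R :=
  if o is Some e then (L ^+ r * Q ^+ e)^-1 else 0.

(** The coefficient [c] is 1 in a leaderless state and [L] while a leader is exempt; the extra
    factor [L] pays for the growth of the others when an output 1 removes the leader. *)
Definition weight (c v : R) : R := Num.min (K * v ^+ p.+2) (c * v).

Let L0 : 0 < L. Proof. by case/andP: L12; lra. Qed.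
Let Q0 : 0 < Q. Proof. by case/andP: Q01. Qed.
Let d0 : 0 <= d. Proof. by rewrite divr_ge0 //; have := G1; lra. Qed.
Let K1 : 1 < K. Proof. by rewrite exprn_egt1. Qed.
Let K0 : 0 <= K. Proof. exact: le_trans ler01 (ltW K1). Qed.

Lemma LQ1 : L * Q <= 1.
Proof.
case/andP: L12 => l1 l2; rewrite leNgt; apply/negP => h.
have : 0 < (L * Q - 1) * (2 - L) by apply: mulr_gt0; lra.
have := sqr_ge0 (L - 1); move: LQ; nra.
Qed.

Lemma base_ge0 r o : 0 <= base r o.
Proof. by case: o => //= e; rewrite invr_ge0 mulr_ge0 ?exprn_ge0 ?ltW. Qed.

Lemma base_step r o : base r o = L * base r.+1 o.
Proof.
case: o => [e|] /=; last by rewrite mulr0.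
by rewrite exprS; field; rewrite !expf_neq0 ?gt_eqF.
Qed.

(** Only an inequality, because a candidate with no error left is excluded and drops to 0. *)
Lemma base_lie r o :
  base r (if o is Some e.+1 then Some e else None) <= L * Q * base r.+1 o.
Proof.
case: o => [[|e]|] /=; last by rewrite mulr0.
  by rewrite !mulr_ge0 ?invr_ge0 ?mulr_ge0 ?exprn_ge0 ?ltW.
rewrite le_eqVlt; apply/orP; left; apply/eqP.
by rewrite !exprS; field; rewrite !expf_neq0 ?gt_eqF.
Qed.

Lemma weight_le_pow c v u : 0 <= v -> v <= u -> weight c v <= K * u ^+ p.+2.
Proof.
move=> v0 vu; rewrite /weight ge_min; apply/orP; left.
by apply: ler_wpM2l; [have := K1; lra | rewrite lerXn2r // nnegrE // (le_trans v0)].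
Qed.

Lemma weight_le_lin c v u : 0 <= c -> v <= u -> weight c v <= c * u.
Proof. by move=> c0 vu; rewrite /weight ge_min ler_wpM2l // orbT. Qed.

Lemma weight0 c : weight c 0 = 0.
Proof. by rewrite /weight expr0n !mulr0 minxx. Qed.

(* The slack [G] between the two terms of [weight] makes every message charged
   at the power term light. *)
Lemma light_le (c v : R) : 0 <= v -> c <= L -> K * v ^+ p.+2 < c * v ->
  K * v ^+ p.+2 <= d.
Proof.
move=> v0 cL h; case/andP: L12 => l1 l2.
have {}v0 : 0 < v.
  by rewrite lt_neqAle v0 andbT; apply: contraTneq h => <-; rewrite expr0n !mulr0 ltxx.
have h2 : (G * v) ^+ p.+1 < 2.
  rewrite exprMn -(ltr_pM2r v0) -mulrA -exprSr; apply: lt_le_trans h _.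
  by apply: ler_wpM2r; [exact: ltW | lra].
have Gv : G * v <= 2.
  rewrite leNgt; apply/negP => Gv; move: h2; rewrite ltNge => /negP; apply.
  rewrite exprS -[leLHS]mulr1; apply: ler_pM => //; first exact: ltW.
  by rewrite exprn_ege1 //; lra.
rewrite (le_trans (ltW h)) // /d ler_pdivlMr; last by have := G1; lra.
have Gv0 : 0 <= G * v by have g1 := G1; rewrite mulr_ge0 ?ltW //; lra.
have := ler_wpM2r Gv0 cL; nra.
Qed.

Definition linear_part (c : R) (r : nat) (s : T -> option nat) (D : {set T}) :=
  [set m in D | c * base r (s m) <= K * base r (s m) ^+ p.+2].

Definition light_sum (c : R) r s (D : {set T}) :=
  \sum_(m in D :\: linear_part c r s D) K * base r (s m) ^+ p.+2.

Lemma weight_sumE c r s (D : {set T}) :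
  \sum_(m in D) weight c (base r (s m)) =
  c * (\sum_(m in linear_part c r s D) base r (s m)) + light_sum c r s D.
Proof.
rewrite (@sum_subset R _ (linear_part c r s D)); last first.
  by apply/subsetP => m; rewrite inE => /andP[].
rewrite mulr_sumr; congr (_ + _); apply: eq_bigr => m; rewrite !inE.
  by move=> /andP[_ h]; rewrite /weight min_r.
by move=> /andP[h mD]; move: h; rewrite mD /= -ltNge => /ltW h; rewrite /weight min_l.
Qed.

(** Among the linearly charged candidates [B] sends 0 and the others send 1; the light ones follow
    [light_split]. The new coefficient [c'] is free: since [weight] is a minimum, each candidate can
    still be bounded by the kind of term it was charged before the step. *)
Lemma weight_step c r s (D B : {set T}) :
  c <= L -> B \subset linear_part c r.+1 s D ->
  let J := linear_part c r.+1 s D in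
  exists2 X : {set T}, X \subset D &
   (forall c', 0 <= c' ->
     \sum_(m in D) weight c' (base r (update s X true m)) <=
       c' * (L * \sum_(m in J :\: B) base r.+1 (s m)) + light_sum c r.+1 s D) /\
   (forall c', 0 <= c' ->
     \sum_(m in D) weight c' (base r (update s X false m)) <=
       c' * (L * (\sum_(m in B) base r.+1 (s m)) +
             L * Q * \sum_(m in J :\: B) base r.+1 (s m))
       + (light_sum c r.+1 s D + 2 * d)).
Proof.
move=> cL BJ J.
have JD : J \subset D by apply/subsetP => m; rewrite inE => /andP[].
pose x m := K * base r.+1 (s m) ^+ p.+2.
have xlight m : m \in D :\: J -> 0 <= x m <= d.
  rewrite !inE => /andP[h mD]; move: h; rewrite mD /= -ltNge => h.
  rewrite (light_le _ cL h) ?base_ge0 // andbT.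
  by apply: mulr_ge0 => //; apply/exprn_ge0/base_ge0.
have [A AD [A1 A0]] := light_split q01 d0 xlight.
have part F : \sum_(m in D) F m = (\sum_(m in B) F m + \sum_(m in J :\: B) F m)
   + (\sum_(m in A) F m + \sum_(m in (D :\: J) :\: A) F m) :> R.
  by rewrite (sum_subset F JD) (sum_subset F BJ) (sum_subset F AD).
have notJ m : m \in A -> (m \in D) && (m \notin J).
  by move=> /(subsetP AD); rewrite inE andbC.
exists ((J :\: B) :|: A).
  by rewrite subUset (subset_trans (subsetDl _ _) JD) (subset_trans AD) ?subsetDl.
have inB m : m \in B -> (m \in (J :\: B) :|: A) = false.
  move=> mB; rewrite !inE mB /=; apply/negP => /notJ /andP[_ /negP]; apply.
  exact: (subsetP BJ).
have inJ m : m \in J :\: B -> m \in (J :\: B) :|: A by move=> h; rewrite inE h.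
have inA m : m \in A -> m \in (J :\: B) :|: A by move=> h; rewrite inE h orbT.
have inO m : m \in (D :\: J) :\: A -> (m \in (J :\: B) :|: A) = false.
  by rewrite !in_setD in_setU in_setD => /andP[/negbTE -> /andP[/negbTE -> _]]; rewrite andbF.
split=> c' c'0; rewrite part.
- have -> : \sum_(m in B) weight c' (base r (update s (J :\: B :|: A) true m)) = 0.
    by apply: big1 => m mB; rewrite /update inB //= weight0.
  have -> : \sum_(m in D :\: J :\: A) weight c' (base r (update s (J :\: B :|: A) true m)) = 0.
    by apply: big1 => m mB; rewrite /update inO //= weight0.
  rewrite add0r addr0; apply: lerD.
    rewrite mulr_sumr mulr_sumr; apply: ler_sum => m mJ.
    by rewrite /update inJ // base_step weight_le_lin.
  apply: le_trans A1; rewrite mulr_sumr; apply: ler_sum => m mA.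
  rewrite /update inA // base_step (le_trans (weight_le_pow _ _ (lexx _))) //.
    by rewrite mulr_ge0 ?base_ge0 ?ltW.
  by rewrite exprMn LE /x mulrCA.
- apply: lerD.
    rewrite mulrDr; apply: lerD; rewrite !mulr_sumr; apply: ler_sum => m mJ.
      by rewrite /update inB // base_step weight_le_lin.
    by rewrite /update inJ // weight_le_lin // base_lie.
  apply: le_trans A0; rewrite addrC; apply: lerD; rewrite mulr_sumr; apply: ler_sum => m mA.
    rewrite /update inO // base_step (le_trans (weight_le_pow _ _ (lexx _))) //.
      by rewrite mulr_ge0 ?base_ge0 ?ltW.
    by rewrite exprMn LE /x mulrCA.
  rewrite /update inA // (le_trans (weight_le_pow _ _ (base_lie _ _))) ?base_ge0 //.
  by rewrite !exprMn LE QE /x mulrCA.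
Qed.

Lemma weight_alive c o : 0 <= c -> o != None -> Num.min K c <= weight c (base 0 o).
Proof.
case: o => // e c0 _ /=; rewrite expr0 mul1r.
have v1 : 1 <= (Q ^+ e)^-1.
  by rewrite invf_ge1 ?exprn_gt0 //; apply: exprn_ile1; case/andP: Q01; lra.
by apply: le_min2; apply: ler_peMr => //; exact: exprn_ege1.
Qed.

Lemma weight_ge0 c r o : 0 <= c -> 0 <= weight c (base r o).
Proof.
move=> c0; have b0 := base_ge0 r o.
by rewrite /weight le_min; apply/andP; split; apply: mulr_ge0 => //; exact: exprn_ge0.
Qed.

(** The reserve [2 * d * r] covers the rounding loss of the light split, at most [2 * d] in each
    remaining step. *)
Definition led (r : nat) (s : T -> option nat) (l : T) :=
  \sum_(m in ~: [set l]) weight L (base r (s m)) <= 1 - 2 * d * r%:R.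

Definition leaderless (r : nat) (s : T -> option nat) :=
  \sum_(m in [set: T]) weight 1 (base r (s m)) <= 1 - 2 * d * r%:R.

Lemma led_step r s l : led r.+1 s l ->
  exists X : {set T}, leaderless r (update s X true) /\ led r (update s X false) l.
Proof.
rewrite /led /leaderless weight_sumE => h.
(* With [B] empty, all heavy candidates except [l] send 1, while [l] lies outside the split set and
   sends 0. *)
have [X XD [h1 h0]] := weight_step (c := L) (lexx _) (sub0set (linear_part L r.+1 s (~: [set l]))).
rewrite setD0 in h1 h0.
have lX : l \notin X by apply/negP => /(subsetP XD); rewrite !inE eqxx.
move: h1 h0 h.
set S1 := \sum_(m in linear_part _ _ _ _) _; set S0 := light_sum _ _ _ _ => h1 h0.
have S1_ge0 : 0 <= S1 by apply: sumr_ge0 => m _; exact: base_ge0.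
rewrite -natr1 => h; have dd := d0; exists X; split.
  rewrite (@sum_subset R _ [set l]) ?subsetT // big_set1 /update (negbTE lX) weight0 add0r.
  rewrite finset.setTD; have := h1 1 ler01; rewrite /update; lra.
have := h0 L (ltW L0); rewrite big_set0 mulr0 add0r => {}h0.
have : L * (L * Q * S1) <= L * S1.
  by rewrite ler_pM2l //; have := LQ1; nra.
by move=> ?; lra.
Qed.

Lemma leaderless_step r s : leaderless r.+1 s ->
  (exists l, led r.+1 s l) \/
  exists X : {set T}, forall b, leaderless r (update s X b).
Proof.
rewrite /leaderless weight_sumE mul1r => h.
move: h; set J := linear_part _ _ _ _; set S1 := \sum_(m in J) _.
set S0 := light_sum _ _ _ _ => h.
case/andP: L12 => l1 l2.
have S1_ge0 : 0 <= S1 by apply: sumr_ge0 => m _; exact: base_ge0.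
(* A leader is a linearly charged candidate holding at least the share [1 - 1 / L] of [S1]:
   exempting it allows the coefficient of the rest to rise to [L]. *)
have [/existsP[l /andP[lJ hl]]|] :=
    boolP [exists l, (l \in J) && (L * (S1 - base r.+1 (s l)) <= S1)].
  left; exists l; rewrite /led.
  apply: le_trans h; have -> : S0 = \sum_(m in setT :\: J) K * base r.+1 (s m) ^+ p.+2 by [].
  rewrite (@sum_subset R _ (J :\ l)); last by apply/subsetP => m; rewrite !inE => /andP[].
  apply: lerD.
    have S1E : S1 = _ := big_setD1 l lJ.
    apply: le_trans hl; rewrite S1E addrC addKr.
    by rewrite mulr_sumr; apply: ler_sum => m _; exact: weight_le_lin (ltW L0) (lexx _).
  have -> : ~: [set l] :\: (J :\ l) = setT :\: J.
    apply/setP => m; rewrite !in_setD in_setC in_set1 in_setT andbT.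
    by have [->|] := eqVneq m l; rewrite ?lJ //= andbT.
  by apply: ler_sum => m _; exact: weight_le_pow (base_ge0 _ _) (lexx _).
rewrite negb_exists => /forallP light; right.
have Jlight m : m \in J -> base r.+1 (s m) <= (L - 1) * S1 / L.
  move=> mJ; have := light m; rewrite mJ /= -ltNge ler_pdivlMr // mulrC; lra.
have e0 : 0 <= (L - 1) * S1 / L.
  by apply: divr_ge0; [apply: mulr_ge0 => //; lra | exact: ltW].
(* Without a leader, [B] can be given a share between [1 - 1 / L] and twice that. The lower bound
   makes output 1 safe; the upper bound makes output 0 safe, and the inequality needed there is
   exactly [LQ]. *)
have [||B BJ /andP[Blo Bhi]] :=
    @subset_sum_approx _ _ J _ ((L - 1) * S1 / L) (2 * ((L - 1) * S1 / L)) _ _ Jlight.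
- rewrite -/S1; apply/andP; split; first by lra.
  by rewrite !mulrA ler_pdivrMr //; nra.
- exact: e0.
have [X _ [h1 h0]] := weight_step (ltW l1) BJ.
exists X; move: (h1 1 ler01) (h0 1 ler01) => {}h1 {}h0.
have := sum_subset (fun m => base r.+1 (s m)) BJ.
rewrite -/J -/S1 -/S0 in h1 h0 *.
move: Blo Bhi h1 h0; set b := \sum_(m in B) _; set a := \sum_(m in J :\: B) _.
move=> Blo Bhi h1 h0 Sab.
have {}Blo : (L - 1) * S1 <= L * b.
  by rewrite [L * b]mulrC -ler_pdivrMr //; lra.
have {}Bhi : L * b <= 2 * ((L - 1) * S1).
  by rewrite [L * b]mulrC -ler_pdivlMr //; lra.
rewrite -natr1 in h; have dd := d0.
case; first by apply: le_trans h1 _; nra.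
apply: le_trans h0 _.
suff : L * b + L * Q * a <= S1 by lra.
have -> : a = S1 - b by lra.
have c1 := LQ1; have := LQ => c2.
have : (L - L * Q) * (L * b) <= (L - L * Q) * (2 * ((L - 1) * S1)).
  by apply: ler_wpM2l => //; lra.
have : 0 <= S1 * ((1 - L * Q) * (2 - L) - 2 * (L - 1) ^+ 2) by apply: mulr_ge0 => //; lra.
move=> u1 u2; rewrite -(ler_pM2l L0); nra.
Qed.

(** With no steps left, a survivor weighs at least 1 for [c = 1] and more than 1 for [c = L]. A
    total of at most 1 thus allows a single survivor, or none besides the leader. *)
Lemma winnable_of_weight r s :
  leaderless r s \/ (exists l, led r s l) -> winnable r s.
Proof.
elim: r s => [|r IH] s.
  rewrite /leaderless /led mulr0 subr0 => -[h|[l h]] m1 m2 a1 a2.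
    apply/eqP/negPn/negP => ne; have := weight_alive ler01 a1.
    have := weight_alive ler01 a2; rewrite (min_r (ltW K1)); move: h.
    rewrite (big_setD1 m1) //= (big_setD1 m2) /=; last by rewrite !inE eq_sym ne.
    set S := \sum_(m in _) _; have : 0 <= S by apply: sumr_ge0 => *; exact: weight_ge0.
    lra.
  have alive_l m : s m != None -> m = l.
    move=> a; apply/eqP/negPn/negP => ne; move: h.
    rewrite (big_setD1 m) /=; last by rewrite !inE.
    set S := \sum_(m in _) _.
    have : 0 <= S by apply: sumr_ge0 => *; apply: weight_ge0; exact: ltW.
    have : 1 < Num.min K L by rewrite lt_min K1; case/andP: L12.
    have := weight_alive (ltW L0) a; lra.
  by rewrite (alive_l m1) // (alive_l m2).
have ledP l : led r.+1 s l -> winnable r.+1 s.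
  by move=> /led_step[X [h1 h0]]; exists X => -[]; apply: IH; [left|right; exists l].
move=> [/leaderless_step[[l /ledP //]|[X h]]|[l /ledP //]].
by exists X => b; apply: IH; left.
Qed.

End Potential.

(** * The volume bound and the choice of [L] and [Q] *)

Lemma achievable_of_volume (R : realFieldType) (L Q q G : R) (p n t k : nat) :
  0 < q < 1 -> 1 < L < 2 -> 0 < Q < 1 -> L ^+ p.+2 = 2 - q -> Q ^+ p.+2 = q ->
  2 * (L - 1) ^+ 2 <= (1 - L * Q) * (2 - L) -> 1 < G ->
  8 * n%:R / G <= 2^-1 ->
  k%:R <= (2 - q) ^+ n * q ^+ t / G ^+ p.+1 / 2 ->
  achievable n t k.
Proof.
move=> q01 L12 Q01 LE QE LQ G1 nG kle; apply: winnable_achievable.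
apply: (winnable_of_weight (R := R) (L := L) (Q := Q) (q := q) (G := G) (p := p)) => //.
left; rewrite /leaderless.
have G0 : G != 0 by rewrite gt_eqF //; lra.
have E8 : 2 * (4 / G) * n%:R = 8 * n%:R / G :> R by field.
(* Half of the total 1 is kept for the rounding reserve [8 * n / G]; the other half bounds the
   initial charges, estimated by their power terms. *)
apply: (@le_trans _ _ 2^-1); last by rewrite E8; lra.
have V0 : 0 < (2 - q) ^+ n * q ^+ t.
  by case/andP: q01 => *; apply: mulr_gt0; apply: exprn_gt0; lra.
have K0 : 0 < G ^+ p.+1 by rewrite exprn_gt0; lra.
apply: (@le_trans _ _ (\sum_(m in [set: 'I_k]) G ^+ p.+1 * ((2 - q) ^+ n * q ^+ t)^-1)).
  apply: ler_sum => m _; rewrite /weight ge_min /base exprVn exprMn -!exprM.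
  by rewrite (mulnC n) (mulnC t) !exprM LE QE lexx.
rewrite sumr_const cardsT card_ord -[leLHS]mulr_natl.
rewrite mulrA ler_pdivrMr //; move: kle.
by rewrite !ler_pdivlMr // => kle; lra.
Qed.

(** With [N = p + 2], [L - 1] is of order [1 / N], while [L * Q] is the [N]-th root of
    [q * (2 - q) < 1], so [1 - L * Q] is also of order [1 / N]. The last inequality compares
    [1 / N ^ 2] with [1 / N] and holds for large [N]. *)
Lemma root_parameters (R : realType) (q : R) : 0 < q < 1 ->
  exists p (L Q : R), [/\ 1 < L < 2, 0 < Q < 1, L ^+ p.+2 = 2 - q,
    Q ^+ p.+2 = q & 2 * (L - 1) ^+ 2 <= (1 - L * Q) * (2 - L)].
Proof.
move=> q01; have /andP[q0 q1] := q01.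
set a := ln (2 - q); set c := - ln (q * (2 - q)).
have a0 : 0 < a by apply: ln_gt0; lra.
have a1 : a <= 1 by have := @le_ln1Dx R (1 - q); rewrite /a (_ : 1 + (1 - q) = 2 - q); lra.
have c0 : 0 < c by rewrite oppr_gt0 ln_lt0 //; apply/andP; split; nra.
(* The final estimate is [8 / N ^ 2 <= c / (2 * (N + c))], that is [16 * (N + c) <= c * N ^ 2]; it
   follows from [N >= 16 + 16 / c]. *)
pose p := Num.truncn (16 + 16 / c).
have [N NpE] : exists N : R, N = p.+2%:R by exists p.+2%:R.
have N0 : 0 < N by rewrite NpE ltr0n.
have NE : 16 + 16 / c <= N.
  have /andP[_ /ltW] : p%:R <= 16 + 16 / c < p.+1%:R.
    by apply: truncn_itv; rewrite addr_ge0 // divr_ge0 // ltW.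
  by rewrite NpE -[p.+2%:R]natr1; lra.
have c16 : 0 < 16 / c by rewrite divr_gt0.
have cN : 16 * c + 16 <= c * N.
  have : c * (16 + 16 / c) <= c * N by rewrite ler_pM2l.
  by rewrite mulrDr mulrCA divff ?gt_eqF // mulr1; lra.
have lnqE : ln q = - c - a.
  by rewrite /c /a lnM ?posrE //; [ring | lra].
exists p, (expR (a / N)), (expR (ln q / N)).
have expXE x : expR (x / N) ^+ p.+2 = expR x.
  by rewrite -expRM_natl -NpE mulrCA divff ?mulr1 ?gt_eqF.
have x0 : 0 < a / N by rewrite divr_gt0.
have x1 : a / N <= N^-1 by rewrite -[leRHS]mul1r ler_pM2r ?invr_gt0.
have N16 : N^-1 <= 16^-1 by rewrite lef_pV2 ?posrE //; lra.
have L1 : 1 < expR (a / N) by rewrite expR_gt1.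
(* [expR (- x) >= 1 - x] bounds [expR x] from above *)
have Lup : expR (a / N) <= 1 + 2 * N^-1.
  have := expR_ge1Dx (- (a / N)); have := expRxMexpNx_1 (a / N).
  have := expR_gt0 (a / N); set E := expR (a / N); set F := expR (- _) => E0 EF F1.
  have : E * (1 - a / N) <= 1 by rewrite -[leRHS]EF ler_pM2l.
  have N'0 : 0 < N^-1 by rewrite invr_gt0.
  have : E * (1 - N^-1) <= E * (1 - a / N) by rewrite ler_pM2l // lerD2l lerN2.
  move=> u1 u2; rewrite leNgt; apply/negP => u3.
  have : (1 + 2 * N^-1) * (1 - N^-1) < E * (1 - N^-1) by rewrite ltr_pM2r //; lra.
  nra.
have LQE : expR (a / N) * expR (ln q / N) = expR (- (c / N)).
  by rewrite -expRD lnqE; congr expR; field; rewrite gt_eqF.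
have cNe : 0 < c / N by rewrite divr_gt0.
have LQup : expR (- (c / N)) * (1 + c / N) <= 1.
  have := expR_ge1Dx (c / N); have := expRxMexpNx_1 (c / N).
  have := expR_gt0 (- (c / N)); set E := expR (c / N); set F := expR (- _) => E0 EF F1.
  by rewrite -[leRHS]EF mulrC ler_pM2r.
split.
- by apply/andP; split => //; lra.
- rewrite expR_gt0 /= expR_lt1 ltr_pdivrMr // mul0r.
  by apply: ln_lt0.
- by rewrite expXE lnK // posrE; lra.
- by rewrite expXE lnK.
- rewrite LQE; move: LQup Lup L1.
  set F := expR (- _); set E := expR _ => LQup Lup L1.
  have h1 : 2 * (E - 1) ^+ 2 <= 8 * N^-1 ^+ 2.
    have : (E - 1) ^+ 2 <= (2 * N^-1) ^+ 2 by rewrite lerXn2r // ?nnegrE; lra.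
    by rewrite exprMn; lra.
  have h2 : c / (N + c) <= 1 - F.
    rewrite ler_pdivrMr; last by lra.
    have : F * (1 + c / N) * N <= 1 * N by rewrite ler_pM2r.
    rewrite -mulrA mulrDl divfK ?gt_eqF //; lra.
  have h3 : 2^-1 <= 2 - E by lra.
  apply: le_trans h1 _; apply: (@le_trans _ _ (c / (N + c) * 2^-1)).
    rewrite exprVn ler_pdivrMr ?exprn_gt0 //.
    have -> : c / (N + c) / 2 * N ^+ 2 = (c * N ^+ 2 / 2) / (N + c).
      by field; rewrite gt_eqF //; lra.
    rewrite ler_pdivlMr; last by lra.
    have : (16 * c + 16) * N <= c * N * N by rewrite ler_pM2r.
    rewrite expr2; nra.
  by apply: ler_pM => //; rewrite ?divr_ge0 //; lra.
Qed.

(** * Lower bounds on [Mnt] *)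

Lemma achievable_le_Mnt n t k : achievable n t k -> (k <= 2 ^ n)%N -> (k <= Mnt n t)%N.
Proof.
move=> ach le_k; rewrite /Mnt.
have lt_k : (k < (2 ^ n).+1)%N by rewrite ltnS.
exact: (@leq_bigmax_cond _ _ (fun i : 'I__ => i : nat) (Ordinal lt_k) (asboolT ach)).
Qed.

Lemma Mnt_gt0 n t : (0 < Mnt n t)%N.
Proof.
apply: achievable_le_Mnt; last by rewrite expn_gt0.
by exists (fun _ _ => false) => m1 m2; rewrite (ord1 m1) (ord1 m2) eqxx.
Qed.

(** [G] grows exponentially in [n], with [G ^ (p + 1) = expR (h * n)], so it beats [16 * n]. The
    threshold is uniform in [t], which later grows with [n]. Rounding to an integer turns the
    denominator 2 into 4. *)
Lemma Mnt_volume (R : realType) (q h : R) : 0 < q < 1 -> 0 < h ->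
  exists N0, forall n t, (N0 <= n)%N ->
    (2 - q) ^+ n * q ^+ t * expR (- (h * n%:R)) / 4 <= (Mnt n t)%:R.
Proof.
move=> q01 h0; have /andP[q0 q1] := q01.
have [p [L [Q [L12 Q01 LE QE LQ]]]] := root_parameters q01.
pose g := h / p.+1%:R; have g0 : 0 < g by rewrite divr_gt0.
(* Beyond [64 / g ^ 2] one has [16 * n <= (g * n / 2) ^ 2], and this square is at most [G]. *)
exists (Num.truncn (64 / g ^+ 2)).+1 => n t len.
have nbig : 64 / g ^+ 2 < n%:R.
  have /truncn_itv/andP[_ /lt_le_trans] : 0 <= 64 / g ^+ 2.
    by rewrite divr_ge0 // exprn_ge0 // ltW.
  by apply; rewrite ler_nat.
have n0 : 0 < n%:R :> R by apply: le_lt_trans nbig; rewrite divr_ge0 // exprn_ge0 // ltW.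
pose G := expR (g * n%:R).
have gn0 : 0 < g * n%:R by rewrite mulr_gt0.
have G1 : 1 < G by rewrite expR_gt1.
have GE : 16 * n%:R <= G.
  have : 1 + g * n%:R / 2 <= expR (g * n%:R / 2) by exact: expR_ge1Dx.
  have : G = expR (g * n%:R / 2) ^+ 2.
    by rewrite -expRM_natl; congr expR; field.
  move=> ->; set E := expR _ => h1.
  have : (g * n%:R / 2) ^+ 2 <= E ^+ 2 by rewrite lerXn2r // ?nnegrE; lra.
  apply: le_trans; move: nbig; rewrite ltr_pdivrMr ?exprn_gt0 // => nbig.
  rewrite exprMn exprMn -mulrA mulrC; have := ltW nbig; move: n0; nra.
have GX : G ^+ p.+1 = expR (h * n%:R).
  by rewrite -expRM_natl mulrA [_ * g]mulrC divfK ?pnatr_eq0.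
set X := (2 - q) ^+ n * q ^+ t * expR (- (h * n%:R)) / 2.
have X0 : 0 <= X.
  by rewrite !mulr_ge0 ?exprn_ge0 ?expR_ge0 //; lra.
have /andP[tX Xt] := truncn_itv X0.
have XM : ((Num.truncn X) <= Mnt n t)%N.
  apply: achievable_le_Mnt.
    apply: (achievable_of_volume q01 L12 Q01 LE QE LQ G1).
      by rewrite ler_pdivrMr; lra.
    by rewrite GX -expRN.
  rewrite -(ler_nat R) (le_trans tX) // natrX /X.
  have b1 : (2 - q) ^+ n <= 2 ^+ n by rewrite lerXn2r // ?nnegrE; lra.
  have b2 : q ^+ t <= 1 by rewrite exprn_ile1 // ltW.
  have b3 : expR (- (h * n%:R)) <= 1 by rewrite expR_le1 oppr_le0 ltW ?mulr_gt0.
  have c1 : 0 <= (2 - q) ^+ n by rewrite exprn_ge0 //; lra.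
  have c2 : 0 <= q ^+ t by rewrite exprn_ge0 // ltW.
  have c3 := expR_ge0 (- (h * n%:R)).
  have u : (2 - q) ^+ n * q ^+ t <= 2 ^+ n * 1 by exact: ler_pM.
  have : (2 - q) ^+ n * q ^+ t * expR (- (h * n%:R)) <= 2 ^+ n * 1 * 1.
    by apply: ler_pM => //; apply: mulr_ge0.
  have : 0 <= 2 ^+ n :> R by rewrite exprn_ge0.
  lra.
have M1 : 1 <= (Mnt n t)%:R :> R by rewrite ler1n Mnt_gt0.
have : (Num.truncn X)%:R <= (Mnt n t)%:R :> R by rewrite ler_nat.
move: Xt; rewrite -natr1 /X; lra.
Qed.

(** * From [Mnt] to the rate *)

Lemma limn_esup_ge (R : realType) (u : nat -> \bar R) x N :
  (forall n, (N <= n)%N -> (x <= u n)%E) -> (x <= limn_esup u)%E.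
Proof.
move=> xu; apply: le_ereal_inf_tmp => _ [A /= [N' _ NA] <-].
apply: (@le_trans _ _ (u (maxn N N'))); first by apply: xu; rewrite leq_maxl.
apply: le_ereal_sup_tmp; exists (u (maxn N N')) => //; exists (maxn N N') => //.
by apply: NA => /=; rewrite leq_maxr.
Qed.

Lemma Rrate_ge0 (R : realType) (tau : R) : (0%:E <= Rrate tau)%E.
Proof.
apply: (@limn_esup_ge _ _ _ 0) => n _; rewrite lee_fin divr_ge0 // /log2.
by rewrite divr_ge0 // ln_ge0 // ?ler1n ?Mnt_gt0.
Qed.

(** For fixed [q] the bound is affine in [tau]: these are the tangent lines of the convex function
    [Rlow]. *)
Lemma Rrate_ge_tangent (R : realType) (q tau : R) : 0 < q < 1 -> 0 <= tau ->
  ((log2 (2 - q) + tau * log2 q)%:E <= Rrate tau)%E.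
Proof.
move=> q01 tau0; have /andP[q0 q1] := q01.
apply/lee_addgt0Pr => e e0.
have l20 : 0 < ln 2 :> R by apply: ln_gt0; lra.
(* One [h * n] is the loss in [Mnt_volume]; a second absorbs [ln 4] from the denominator and
   [- ln q] from rounding [tau * n] up. *)
pose h := e * ln 2 / 2; have h0 : 0 < h by rewrite !mulr_gt0.
have [N0 HN] := Mnt_volume q01 h0.
have lnq : ln q < 0 by exact: ln_lt0.
have ln4 : 0 < ln 4 :> R by apply: ln_gt0; lra.
pose C := (ln 4 - ln q) / h.
have C0 : 0 < C by rewrite divr_gt0 //; lra.
rewrite -leeBlDr //.
apply: (@limn_esup_ge _ _ _ (maxn N0 (Num.truncn C).+1)) => n; rewrite geq_max => /andP[N0n Cn].
have {}Cn : C < n%:R.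
  have /andP[_ /lt_le_trans] := truncn_itv (ltW C0).
  by apply; rewrite ler_nat.
have n0 : 0 < n%:R :> R by apply: lt_trans Cn.
set t := `|_|%N.
have tE : t%:R <= tau * n%:R + 1.
  have c0 : 0 <= Num.ceil (tau * n%:R) by rewrite ceil_ge0 (lt_le_trans (ltrN10 _)) // mulr_ge0.
  have := ceilB1_lt (tau * n%:R); rewrite intrB -[Num.ceil _]gez0_abs // -/t.
  by rewrite -pmulrn mulr1z; lra.
have := HN n t N0n; set M := (Mnt n t)%:R.
have M0 : 0 < M by rewrite ltr0n Mnt_gt0.
have P1 : 0 < (2 - q) ^+ n by rewrite exprn_gt0 //; lra.
have P2 : 0 < q ^+ t by rewrite exprn_gt0.
have P3 := expR_gt0 (- (h * n%:R)).
rewrite -ler_ln ?posrE ?divr_gt0 ?mulr_gt0 //.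
rewrite ln_div ?posrE ?mulr_gt0 // !lnM ?posrE ?mulr_gt0 // expRK !lnXn //; last by lra.
move=> hM; rewrite -EFinB lee_fin ler_pdivlMr // /log2 ler_pdivlMr //.
have -> : (ln (2 - q) / ln 2 + tau * (ln q / ln 2) - e) * n%:R * ln 2 =
  ln (2 - q) * n%:R + (tau * n%:R) * ln q - 2 * h * n%:R.
  by rewrite /h; field; rewrite gt_eqF.
apply: le_trans hM; rewrite -(mulr_natr (ln (2 - q))) -(mulr_natr (ln q)).
have : (tau * n%:R + 1) * ln q <= t%:R * ln q by rewrite ler_nM2r.
have : ln 4 - ln q <= h * n%:R.
  by rewrite mulrC -ler_pdivrMr // ltW.
rewrite [ln q * _]mulrC; lra.
Qed.

Unset Implicit Arguments.

Theorem theorem1 (R : realType) (tau : R) :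
  0 <= tau -> tau <= 1 -> ((Rlow tau)%:E <= Rrate tau)%E.
Proof.
move=> tau0 tau1.
have l20 : 0 < ln 2 :> R by apply: ln_gt0; lra.
have log22 : log2 2 = 1 :> R by rewrite /log2 divff ?gt_eqF.
have log21 : log2 1 = 0 :> R by rewrite /log2 ln1 mul0r.
have log2_div (x y : R) : 0 < x -> 0 < y -> log2 (x / y) = log2 x - log2 y.
  by move=> x0 y0; rewrite /log2 ln_div ?posrE // mulrBl.
have [->|tauN1] := eqVneq tau 1.
  suff -> : Rlow 1 = 0 :> R by exact: Rrate_ge0.
  rewrite /Rlow /xlog2x oner_eq0 log21.
  have -> : 1 + 1 = 2 :> R by lra.
  by rewrite log22; lra.
have {tauN1}tau1 : tau < 1 by rewrite lt_neqAle tauN1.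
(* The optimal [q] would be 0, which is not allowed. Instead [2 - q = 2 ^ (1 - x)] with [0 < x <= e]
   gives the rate [1 - x]. *)
have [tauE|tauN0] := eqVneq tau 0.
  have -> : Rlow tau = 1.
    by rewrite /Rlow /xlog2x tauE eqxx !addr0 log21; lra.
  apply/lee_addgt0Pr => e e0.
  pose x := e / (1 + e).
  have x0 : 0 < x by rewrite divr_gt0 //; lra.
  have x1 : x < 1 by rewrite ltr_pdivrMr; lra.
  have xe : x <= e by rewrite ler_pdivrMr; nra.
  pose y := expR (- (x * ln 2)).
  have y1 : y < 1 by rewrite expR_lt1 oppr_lt0 mulr_gt0.
  have y2 : 1 < 2 * y.
    rewrite -{1}(@lnK R 2) ?posrE // -expRD expR_gt1.
    by have : x * ln 2 < 1 * ln 2 :> R; [rewrite ltr_pM2r | lra].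
  have q01 : 0 < 2 - 2 * y < 1 by apply/andP; split; lra.
  have := Rrate_ge_tangent q01 tau0.
  have -> : 2 - (2 - 2 * y) = 2 * y by lra.
  have -> : log2 (2 * y) = 1 - x.
    rewrite /log2 lnM ?posrE ?expR_gt0 // expRK; field.
    by rewrite gt_eqF.
  rewrite tauE mul0r addr0 => h; rewrite -leeBlDr //.
  by apply: le_trans h; rewrite -EFinB lee_fin; lra.
have {tauN0}tau0 : 0 < tau by rewrite lt_neqAle eq_sym tauN0.
(* This [q] maximises [log2 (2 - q) + tau * log2 q], and the maximum is [Rlow tau]. *)
have q01 : 0 < 2 * tau / (1 + tau) < 1.
  by rewrite divr_gt0 ?ltr_pdivrMr //=; lra.
have := Rrate_ge_tangent q01 (ltW tau0).
have -> : 2 - 2 * tau / (1 + tau) = 2 / (1 + tau) by field; rewrite gt_eqF //; lra.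
rewrite !log2_div //; [|lra..].
have -> : log2 (2 * tau) = 1 + log2 tau.
  by rewrite /log2 lnM ?posrE // mulrDl divff ?gt_eqF.
rewrite log22; congr (_%:E <= _)%E.
by rewrite /Rlow /xlog2x gt_eqF //; ring.
Qed.
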